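(* For a weakly modular graph $G$ the following are equivalent: (i) there exists $\delta$ such that $G$ is $\delta$--hyperbolic; (ii) there exist $\mu,\kappa$ such that all metric triangles of $G$ have sides of length at most $\mu$ and $G$ does not contain isometric square grids of side $\kappa$.
   Context: Graphs are simple, undirected, connected, possibly infinite; $d$ graph distance, $I(u,v)=\{x:d(u,x)+d(x,v)=d(u,v)\}$. Weakly modular: for every vertex $u$, (TC) for $v,w$ with $1=d(v,w)<d(u,v)=d(u,w)$ there is a common neighbor $x$ of $v,w$ with $d(u,x)=d(u,v)-1$, and (QC) for $v,w,z$ with $d(v,z)=d(w,z)=1$, $2=d(v,w)\le d(u,v)=d(u,w)=d(u,z)-1$ there is a common neighbor $x$ of $v,w$ with $d(u,x)=d(u,v)-1$. $G$ is $\delta$--hyperbolic if for any four vertices $u,v,x,y$ the two largest of the sums $d(u,v)+d(x,y)$, $d(u,x)+d(v,y)$, $d(u,y)+d(v,x)$ differ by at most $2\delta$. Vertices $v_1,v_2,v_3$ form a metric triangle if $I(v_i,v_j)\cap I(v_i,v_k)=\{v_i\}$ for all distinct $i,j,k$; its sides are the distances $d(v_i,v_j)$. A square grid of side $k$ is the Cartesian product of two paths with $k$ edges each ($(k+1)\times(k+1)$ vertices); it is isometric in $G$ if it is a subgraph of $G$ whose distances equal those in $G$. *)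

(* Defs.v *)
From Stdlib Require Import Reals Lia Arith ClassicalEpsilon.
Open Scope nat_scope.

Section Graphs.
Variable V : Type.
Variable adj : V -> V -> Prop.

Inductive walk : V -> V -> nat -> Prop :=
| walk0 : forall u, walk u u 0
| walkS : forall u w v n, adj u w -> walk w v n -> walk u v (S n).

Definition simple_graph : Prop :=
  (forall x y, adj x y -> adj y x) /\ (forall x, ~ adj x x).

Definition connected : Prop := forall u v, exists n, walk u v n.

(* graph distance: the least length of a walk (meaningful for connected graphs) *)
Definition gdist (u v : V) : nat :=
  epsilon (inhabits 0) (fun n => walk u v n /\ forall m, walk u v m -> n <= m).

Definition in_interval (u v x : V) : Prop :=
  gdist u x + gdist x v = gdist u v.

Definition triangle_condition : Prop :=
  forall u v w, gdist v w = 1 -> 1 < gdist u v -> gdist u v = gdist u w ->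
    exists x, adj v x /\ adj w x /\ gdist u x = gdist u v - 1.

Definition quadrangle_condition : Prop :=
  forall u v w z, gdist v z = 1 -> gdist w z = 1 -> gdist v w = 2 ->
    2 <= gdist u v -> gdist u v = gdist u w -> gdist u z = gdist u v + 1 ->
    exists x, adj v x /\ adj w x /\ gdist u x = gdist u v - 1.

Definition weakly_modular : Prop := triangle_condition /\ quadrangle_condition.

(* four-point condition: the two largest of the three sums differ by at most 2 delta *)
Definition hyperbolic (delta : R) : Prop :=
  forall u v x y,
    let a := gdist u v + gdist x y in
    let b := gdist u x + gdist v y in
    let c := gdist u y + gdist v x in
    (b <= a -> c <= a -> (INR a - INR (Nat.max b c) <= 2 * delta)%R) /\
    (a <= b -> c <= b -> (INR b - INR (Nat.max a c) <= 2 * delta)%R) /\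
    (a <= c -> b <= c -> (INR c - INR (Nat.max a b) <= 2 * delta)%R).

Definition metric_triangle (v1 v2 v3 : V) : Prop :=
  let cond vi vj vk := forall x, in_interval vi vj x -> in_interval vi vk x -> x = vi in
  cond v1 v2 v3 /\ cond v2 v1 v3 /\ cond v3 v1 v2.

Definition absdiff (a b : nat) : nat := (a - b) + (b - a).

Definition isometric_grid (k : nat) (f : nat -> nat -> V) : Prop :=
  (forall i j i' j', i <= k -> j <= k -> i' <= k -> j' <= k ->
     f i j = f i' j' -> i = i' /\ j = j') /\
  (forall i j, i < k -> j <= k -> adj (f i j) (f (S i) j)) /\
  (forall i j, i <= k -> j < k -> adj (f i j) (f i (S j))) /\
  (forall i j i' j', i <= k -> j <= k -> i' <= k -> j' <= k ->
     gdist (f i j) (f i' j') = absdiff i i' + absdiff j j').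

End Graphs.

(* Main.v *)
Require Import Defs.
From Stdlib Require Import Reals Lra Lia Arith Classical ClassicalEpsilon.

(** From hyperbolicity to (ii): opposite corners of an isometric grid violate the
    four-point condition.  For a metric triangle [u], [v], [w], choose a geodesic
    from [v] to [w] minimizing the sum of the distances to [u].  By (TC) and (QC)
    the distance to [u] has no peak along it, so it decreases, stays constant, then
    increases; the metric triangle excludes the first and the last phase.  Hence
    metric triangles are equilateral with a midpoint of [v w] as far from [u] as
    [v] is, and the four-point condition bounds their size.

    Conversely, let [mu] bound the metric triangles.  Every triple [u x y] has a
    quasi-median, so [I(u,x)] and [I(u,y)] share a point at distance at least
    [(x|y)_u - mu] from [u].  If [x], [y] in [I(u,v)] are equidistant from [u] and
    far apart, this gives a long geodesic from [x] towards both [u] and [y] and one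
    towards both [v] and [y]; (QC) applied with respect to [y] completes them to a
    grid, which is isometric since the distances to [u] and to [y] both vary at full
    speed on it.  So intervals are thin, and comparing points of [I(u,y)] yields
    the four-point condition. *)

Section WeaklyModular.
Context (V : Type) (adj : V -> V -> Prop).
Context (Hsimple : simple_graph V adj) (Hconn : connected V adj).

Local Notation d := (gdist V adj).
Local Notation "x ~~ y" := (adj x y) (at level 70).

(** * Walks, graph distance and geodesics *)

Lemma adj_sym x y : x ~~ y -> y ~~ x.
Proof. exact (proj1 Hsimple x y). Qed.

Lemma least_nat (P : nat -> Prop) :
  (exists n, P n) -> exists n, P n /\ forall m, P m -> n <= m.
Proof.
  intros [n Hn]; revert Hn; induction n as [n IH] using lt_wf_ind; intro Hn.
  destruct (classic (exists m, m < n /\ P m)) as [[m [Hm HP]]|Hno].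
  - exact (IH m Hm HP).
  - exists n; split; [exact Hn|]; intros m HP.
    destruct (le_lt_dec n m); [assumption|]; exfalso; apply Hno; eauto.
Qed.

(** Connectedness makes the set of walk lengths nonempty, so the [epsilon] in [gdist] does pick its
    minimum. *)
Lemma gdist_spec u v : walk V adj u v (d u v) /\ forall m, walk V adj u v m -> d u v <= m.
Proof.
  unfold gdist; apply epsilon_spec; apply least_nat; apply Hconn.
Qed.

Lemma walk_app u v w m n : walk V adj u v m -> walk V adj v w n -> walk V adj u w (m + n).
Proof.
  intro H; induction H; intro H'; simpl; [exact H'|].
  eapply walkS; eauto.
Qed.

Lemma walk_rev u v n : walk V adj u v n -> walk V adj v u n.
Proof.
  intro H; induction H as [u|u w v n Huw _ IH]; [constructor|].
  replace (S n) with (n + 1) by lia.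
  apply walk_app with w; [exact IH|].
  eapply walkS; [apply adj_sym; exact Huw|constructor].
Qed.

Lemma gdist_triangle u v w : d u w <= d u v + d v w.
Proof.
  apply gdist_spec; apply walk_app with v; apply gdist_spec.
Qed.

Lemma gdist_sym u v : d u v = d v u.
Proof.
  apply Nat.le_antisymm; apply gdist_spec; apply walk_rev; apply gdist_spec.
Qed.

(** For [lia], [d a b] and [d b a] are unrelated atoms; one symmetry equation is added per pair, and
    the guards prevent looping. *)
Ltac dist_lia :=
  repeat match goal with
  | H : context [gdist V adj ?a ?b] |- _ =>
      lazymatch goal with
      | _ : gdist V adj a b = gdist V adj b a |- _ => fail
      | _ : gdist V adj b a = gdist V adj a b |- _ => fail
      | _ => pose proof (gdist_sym a b)
      end
  | |- context [gdist V adj ?a ?b] =>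
      lazymatch goal with
      | _ : gdist V adj a b = gdist V adj b a |- _ => fail
      | _ : gdist V adj b a = gdist V adj a b |- _ => fail
      | _ => pose proof (gdist_sym a b)
      end
  end; lia.

Lemma gdist_refl u : d u u = 0.
Proof.
  enough (d u u <= 0) by lia; apply gdist_spec; constructor.
Qed.

Lemma gdist_eq0 u v : d u v = 0 -> u = v.
Proof.
  intro H; destruct (gdist_spec u v) as [W _]; rewrite H in W; inversion W; auto.
Qed.

Lemma gdist_adj u v : u ~~ v -> d u v = 1.
Proof.
  intro H; assert (d u v <= 1).
  { apply gdist_spec; eapply walkS; [exact H|constructor]. }
  destruct (Nat.eq_dec (d u v) 0) as [E|]; [|lia].
  apply gdist_eq0 in E; subst; destruct (proj2 Hsimple v H).
Qed.

Lemma adj_gdist u v : d u v = 1 -> u ~~ v.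
Proof.
  intro H; destruct (gdist_spec u v) as [W _]; rewrite H in W.
  inversion W as [|? w ? ? Huw W']; subst; inversion W'; subst; exact Huw.
Qed.

Lemma gdist_step u v n : d u v = S n -> exists w, u ~~ w /\ d w v = n.
Proof.
  intro H; destruct (gdist_spec u v) as [W _]; rewrite H in W.
  inversion W as [|? w ? ? Huw W']; subst; exists w; split; [exact Huw|].
  assert (d w v <= n) by (apply gdist_spec; exact W').
  pose proof (gdist_triangle u w v); rewrite (gdist_adj _ _ Huw) in *; lia.
Qed.

Definition is_path (p : nat -> V) (n : nat) : Prop := forall i, i < n -> p i ~~ p (S i).

Definition is_geodesic (v w : V) (p : nat -> V) : Prop :=
  p 0 = v /\ p (d v w) = w /\ is_path p (d v w).

Lemma geodesic_exists v w : exists p, is_geodesic v w p.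
Proof.
  unfold is_geodesic; remember (d v w) as n eqn:E; revert v E.
  induction n as [|n IH]; intros v E.
  - apply eq_sym, gdist_eq0 in E; subst w.
    exists (fun _ => v); repeat split; intros i Hi; lia.
  - destruct (gdist_step v w n (eq_sym E)) as [x [Hvx Hx]].
    destruct (IH x (eq_sym Hx)) as [p [H0 [Hn Hp]]].
    exists (fun i => match i with 0 => v | S i => p i end); repeat split; [exact Hn|].
    intros [|i] Hi; [rewrite H0; exact Hvx|apply Hp; lia].
Qed.

Lemma path_gdist p n i j : is_path p n -> i <= j -> j <= n -> d (p i) (p j) <= j - i.
Proof.
  intros Hp; induction j as [|j IH]; intros Hij Hjn.
  - replace i with 0 by lia; rewrite gdist_refl; lia.
  - destruct (Nat.eq_dec i (S j)) as [->|]; [rewrite gdist_refl; lia|].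
    specialize (IH ltac:(lia) ltac:(lia)).
    pose proof (gdist_triangle (p i) (p j) (p (S j))).
    rewrite (gdist_adj (p j) (p (S j))) in * by (apply Hp; lia); lia.
Qed.

(** The pieces before [p i] and after [p j] are too short to allow a shortcut in the middle. *)
Lemma geodesic_gdist v w p i j :
  is_geodesic v w p -> i <= j -> j <= d v w -> d (p i) (p j) = j - i.
Proof.
  intros [H0 [Hn Hp]] Hij Hj.
  pose proof (path_gdist p _ i j Hp Hij Hj).
  pose proof (path_gdist p _ 0 i Hp ltac:(lia) ltac:(lia)) as A.
  pose proof (path_gdist p _ j _ Hp Hj (le_n _)) as B.
  rewrite H0 in A; rewrite Hn in B.
  pose proof (gdist_triangle v (p i) w); pose proof (gdist_triangle (p i) (p j) w); lia.
Qed.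

Lemma geodesic_interval v w p i :
  is_geodesic v w p -> i <= d v w -> d v (p i) = i /\ d (p i) w = d v w - i.
Proof.
  intros Hp Hi; destruct (Hp) as [H0 [Hn _]].
  pose proof (geodesic_gdist v w p 0 i Hp ltac:(lia) Hi) as A.
  pose proof (geodesic_gdist v w p i _ Hp Hi (le_n _)) as B.
  rewrite H0 in A; rewrite Hn in B; lia.
Qed.

(** * Quasi-medians and common prefixes of intervals *)

Lemma interval_maximal (P : V -> Prop) v N :
  (exists x, P x) -> (forall x, P x -> d v x <= N) ->
  exists x, P x /\ forall z, P z -> d v z <= d v x.
Proof.
  intros [x0 H0] HN.
  (* Maximizing [d v x] amounts to minimizing its complement to [N]. *)
  destruct (least_nat (fun n => exists x, P x /\ n + d v x = N)) as [n [[x [Hx En]] Hmin]].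
  - exists (N - d v x0), x0; split; [exact H0|]; specialize (HN _ H0); lia.
  - exists x; split; [exact Hx|]; intros z Hz.
    specialize (Hmin (N - d v z)); pose proof (HN _ Hz).
    enough (n <= N - d v z) by lia.
    apply Hmin; exists z; split; [exact Hz|lia].
Qed.

Lemma common_interval_maximal v a b :
  exists x, in_interval V adj v a x /\ in_interval V adj v b x /\
    forall z, in_interval V adj v a z -> in_interval V adj v b z -> d v z <= d v x.
Proof.
  destruct (interval_maximal
    (fun x => in_interval V adj v a x /\ in_interval V adj v b x) v (d v a)) as [x [[Ha Hb] Hm]].
  - exists v; unfold in_interval; rewrite gdist_refl; auto.
  - intros x [H _]; unfold in_interval in H; lia.
  - exists x; repeat split; auto.
Qed.

Definition metric_triangles_le (mu : nat) : Prop :=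
  forall v1 v2 v3, metric_triangle V adj v1 v2 v3 ->
    d v1 v2 <= mu /\ d v2 v3 <= mu /\ d v1 v3 <= mu.

(** The corners are chosen in turn, each as far as possible from its own vertex [u], [x], [y]. A
    second point in the intersection of two intervals at a corner would contradict this
    maximality. *)
Lemma quasi_median u x y : exists u' x' y',
  metric_triangle V adj u' x' y' /\
  d u x = d u u' + d u' x' + d x' x /\
  d u y = d u u' + d u' y' + d y' y /\
  d x y = d x x' + d x' y' + d y' y.
Proof.
  unfold metric_triangle.
  destruct (common_interval_maximal u x y) as [u' [U1 [U2 U3]]].
  destruct (common_interval_maximal x u' y) as [x' [X1 [X2 X3]]].
  destruct (common_interval_maximal y u' x') as [y' [Y1 [Y2 Y3]]].
  unfold in_interval in *.
  exists u', x', y'; repeat split; try dist_lia;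
    intros z Z1 Z2; symmetry; apply gdist_eq0.
  - specialize (U3 z).
    pose proof (gdist_triangle z x' x); pose proof (gdist_triangle z y' y).
    pose proof (gdist_triangle u z x); pose proof (gdist_triangle u z y).
    pose proof (gdist_triangle u u' z); dist_lia.
  - specialize (X3 z).
    pose proof (gdist_triangle z y' y); pose proof (gdist_triangle x z u').
    pose proof (gdist_triangle x z y); pose proof (gdist_triangle x x' z); dist_lia.
  - specialize (Y3 z).
    pose proof (gdist_triangle y z u'); pose proof (gdist_triangle y z x').
    pose proof (gdist_triangle y y' z); dist_lia.
Qed.

(* The conclusion reads [(x|y)_u - mu <= d u c] for the Gromov product of [x] and [y]. *)
Lemma common_prefix mu u x y : metric_triangles_le mu ->
  exists c, in_interval V adj u x c /\ in_interval V adj u y c /\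
    d u x + d u y <= d x y + 2 * d u c + 2 * mu.
Proof.
  intro Hmu.
  destruct (quasi_median u x y) as [u' [x' [y' [M [E1 [E2 E3]]]]]].
  destruct (Hmu _ _ _ M) as [A [B C]].
  exists u'; unfold in_interval.
  pose proof (gdist_triangle u u' x); pose proof (gdist_triangle u' x' x).
  pose proof (gdist_triangle u u' y); pose proof (gdist_triangle u' y' y).
  dist_lia.
Qed.

(** * Peakless geodesics from (TC) and (QC) *)

Section Modularity.
Context (Hwm : weakly_modular V adj).

(** Extends (TC) to distance 1, where [u] itself is the common neighbor. *)
Lemma triangle_common_neighbor u v w : v ~~ w -> d u v = d u w -> 0 < d u v ->
  exists x, v ~~ x /\ w ~~ x /\ d u x + 1 = d u v.
Proof.
  intros Hvw E Hpos.
  destruct (Nat.eq_dec (d u v) 1) as [E1|].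
  - exists u; rewrite gdist_refl; repeat split; [| |lia];
      apply adj_sym, adj_gdist; lia.
  - destruct (proj1 Hwm u v w (gdist_adj _ _ Hvw) ltac:(lia) E) as [x [A [B C]]].
    exists x; repeat split; auto; lia.
Qed.

Lemma quadrangle_common_neighbor u v w z : v ~~ z -> w ~~ z -> d v w = 2 ->
  d u v = d u w -> d u z = d u v + 1 ->
  exists x, v ~~ x /\ w ~~ x /\ d u x + 1 = d u v.
Proof.
  intros Hvz Hwz E2 E Ez.
  assert (d u v <> 0).
  { intro E0; assert (d u w = 0) as E0' by lia.
    apply gdist_eq0 in E0, E0'; subst; rewrite gdist_refl in E2; lia. }
  destruct (Nat.eq_dec (d u v) 1) as [E1|].
  - exists u; rewrite gdist_refl; repeat split; [| |lia];
      apply adj_sym, adj_gdist; lia.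
  - destruct (proj2 Hwm u v w z (gdist_adj _ _ Hvz) (gdist_adj _ _ Hwz) E2
      ltac:(lia) E Ez) as [x [A [B C]]].
    exists x; repeat split; auto; lia.
Qed.

(** The local move that removes a peak or the end of a plateau at [y]. *)
Lemma shortcut_below u a y b : a ~~ y -> y ~~ b -> d a b = 2 ->
  d u a <= d u y -> d u b < d u y ->
  exists t, a ~~ t /\ t ~~ b /\ d u t < d u y.
Proof.
  intros Hay Hyb E2 La Lb.
  pose proof (gdist_adj _ _ Hay); pose proof (gdist_adj _ _ Hyb).
  pose proof (gdist_triangle u a y); pose proof (gdist_triangle u b y).
  rewrite (gdist_sym b y) in *.
  destruct (Nat.eq_dec (d u a) (d u y)) as [Ea|].
  - destruct (triangle_common_neighbor u a y Hay Ea ltac:(lia)) as [z [Haz [Hyz Ez]]].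
    pose proof (gdist_adj _ _ Haz).
    destruct (classic (z ~~ b)) as [Hzb|Hzb]; [exists z; repeat split; auto; lia|].
    assert (d b z = 2) as Ebz.
    { pose proof (gdist_triangle b y z).
      rewrite (gdist_sym b y), (gdist_adj y z) in * by assumption.
      destruct (Nat.eq_dec (d b z) 0) as [E|]; [apply gdist_eq0 in E; subst; lia|].
      destruct (Nat.eq_dec (d b z) 1) as [E|]; [|lia].
      destruct Hzb; apply adj_sym, adj_gdist; exact E. }
    destruct (quadrangle_common_neighbor u b z y) as [s [Hbs [Hzs Es]]];
      try (apply adj_sym; assumption); auto; try lia.
    pose proof (gdist_adj _ _ Hzs); pose proof (gdist_triangle a z s).
    pose proof (gdist_triangle u s a); rewrite (gdist_sym s a) in *.
    (* Here (TC) is based at [a]: both [b] and [s] are at distance 2 from it, since [s] is two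
       levels below [a] and reached through [z]. *)
    destruct (triangle_common_neighbor a b s Hbs ltac:(lia) ltac:(lia)) as [t [Hbt [Hst Et]]].
    exists t; repeat split; [apply adj_gdist; lia|apply adj_sym; exact Hbt|].
    pose proof (gdist_triangle u s t); rewrite (gdist_adj _ _ Hst) in *; lia.
  - destruct (quadrangle_common_neighbor u a b y) as [t [Hat [Hbt Et]]];
      auto using adj_sym; try lia.
    exists t; repeat split; auto using adj_sym; lia.
Qed.

Fixpoint total (f : nat -> nat) (n : nat) : nat :=
  match n with 0 => f 0 | S n' => total f n' + f n end.

Lemma total_le f g n : (forall i, i <= n -> f i <= g i) -> total f n <= total g n.
Proof.
  induction n as [|n IH]; intro H; simpl; [apply H; lia|].
  pose proof (H (S n) (le_n _)); specialize (IH (fun i Hi => H i ltac:(lia))); lia.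
Qed.

Lemma total_lt f g n k : (forall i, i <= n -> f i <= g i) -> k <= n -> f k < g k ->
  total f n < total g n.
Proof.
  induction n as [|n IH]; intros H Hk L; simpl.
  - replace k with 0 in L by lia; exact L.
  - pose proof (H (S n) (le_n _)).
    destruct (Nat.eq_dec k (S n)) as [->|].
    + pose proof (total_le f g n (fun i Hi => H i ltac:(lia))); lia.
    + specialize (IH (fun i Hi => H i ltac:(lia)) ltac:(lia) L); lia.
Qed.

(** Stated so that it propagates: a descent is preceded only by descents, a rise is followed only by
    rises. *)
Lemma geodesic_peakless u v w : exists p, is_geodesic v w p /\
  forall i, S (S i) <= d v w -> forall m, d u (p (S i)) = m ->
    (d u (p (S (S i))) < m -> m < d u (p i)) /\
    (d u (p i) < m -> m < d u (p (S (S i)))).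
Proof.
  destruct (least_nat (fun s => exists p, is_geodesic v w p /\
    total (fun i => d u (p i)) (d v w) = s)) as [s [[p [Hp Es]] Hmin]].
  { destruct (geodesic_exists v w) as [p Hp]; eauto. }
  (* Replacing one vertex by a vertex closer to [u] leaves a geodesic with a smaller total. *)
  assert (Hrep : forall i t, S (S i) <= d v w -> p i ~~ t -> t ~~ p (S (S i)) ->
    d u t < d u (p (S i)) -> False).
  { intros i t Hi H1 H2 L.
    pose (q := fun j => if j =? S i then t else p j).
    assert (total (fun i => d u (q i)) (d v w) < s).
    { rewrite <- Es; apply total_lt with (S i); [|lia|].
      - intros j _; unfold q; destruct (Nat.eqb_spec j (S i)); [subst; lia|lia].
      - unfold q; rewrite Nat.eqb_refl; exact L. }
    enough (s <= total (fun i => d u (q i)) (d v w)) by lia.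
    apply Hmin; exists q; split; [|reflexivity].
    destruct Hp as [H0 [Hn Hadj]]; repeat split; unfold q.
    - exact H0.
    - destruct (Nat.eqb_spec (d v w) (S i)); [lia|exact Hn].
    - intros j Hj; destruct (Nat.eqb_spec j (S i)) as [E|];
        destruct (Nat.eqb_spec (S j) (S i)) as [E'|]; try lia.
      + rewrite E; exact H2.
      + injection E' as ->; exact H1.
      + apply Hadj; exact Hj. }
  exists p; split; [exact Hp|]; intros i Hi m <-.
  assert (p i ~~ p (S i)) by (apply Hp; lia).
  assert (p (S i) ~~ p (S (S i))) by (apply Hp; lia).
  assert (d (p i) (p (S (S i))) = 2).
  { rewrite (geodesic_gdist v w p) by (auto; lia); lia. }
  split; intro L; apply Nat.nle_gt; intro L'.
  - destruct (shortcut_below u (p i) (p (S i)) (p (S (S i)))) as [t [A [B C]]]; auto.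
    exact (Hrep i t Hi A B C).
  - destruct (shortcut_below u (p (S (S i))) (p (S i)) (p i)) as [t [A [B C]]];
      auto using adj_sym.
    { rewrite gdist_sym; assumption. }
    exact (Hrep i t Hi (adj_sym _ _ B) (adj_sym _ _ A) C).
Qed.

(** * Metric triangles are equilateral *)

Lemma metric_triangle_equidistant u v w : metric_triangle V adj u v w ->
  exists p, is_geodesic v w p /\ forall i, i <= d v w -> d u (p i) = d u v.
Proof.
  intros [_ [Mv Mw]].
  destruct (geodesic_peakless u v w) as [p [Hp Hpk]].
  exists p; split; [exact Hp|].
  set (n := d v w) in *.
  assert (Hstep : forall i, i < n -> d u (p i) <= d u (p (S i)) + 1 /\
    d u (p (S i)) <= d u (p i) + 1).
  { intros i Hi; assert (d (p i) (p (S i)) = 1) as E by (apply gdist_adj, Hp, Hi).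
    pose proof (gdist_triangle u (p i) (p (S i))).
    pose proof (gdist_triangle u (p (S i)) (p i)).
    rewrite (gdist_sym (p (S i)) (p i)) in *; lia. }
  (* A descent would propagate back to the first edge, putting [p 1] in both intervals at [v]. *)
  assert (Hdrop : forall i, i < n -> d u (p i) <= d u (p (S i))).
  { induction i as [|i IH]; intro Hi.
    - apply Nat.nlt_ge; intro L.
      destruct (geodesic_interval v w p 1 Hp Hi) as [A B].
      assert (p 1 = v) as E.
      { apply Mv; unfold in_interval; [|fold n in B; lia].
        specialize (Hstep 0 Hi); rewrite (proj1 Hp) in *.
        rewrite (gdist_sym v u), (gdist_sym (p 1) u); lia. }
      rewrite E, gdist_refl in A; lia.
    - apply Nat.nlt_ge; intro L.
      pose proof (proj1 (Hpk i ltac:(lia) _ eq_refl) L).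
      specialize (IH ltac:(lia)); lia. }
  (* Symmetrically, a rise would propagate to the last edge; hence the induction on the distance [k]
     to the end. *)
  assert (Hrise : forall k i, i + S k = n -> d u (p (S i)) <= d u (p i)).
  { induction k as [|k IH]; intros i Hi.
    - apply Nat.nlt_ge; intro L.
      destruct (geodesic_interval v w p i Hp ltac:(lia)) as [A B].
      assert (p i = w) as E.
      { apply Mw; unfold in_interval.
        - specialize (Hstep i ltac:(lia)).
          replace (p (S i)) with w in *; [dist_lia|].
          rewrite <- (proj1 (proj2 Hp)); f_equal; fold n; lia.
        - unfold n in *; dist_lia. }
      rewrite E, gdist_refl in B; fold n in B; lia.
    - apply Nat.nlt_ge; intro L.
      pose proof (proj2 (Hpk i ltac:(lia) _ eq_refl) L).
      specialize (IH (S i) ltac:(lia)); lia. }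
  induction i as [|i IH]; intro Hi; [rewrite (proj1 Hp); reflexivity|].
  specialize (IH ltac:(lia)); specialize (Hdrop i ltac:(lia)).
  specialize (Hrise (n - S i) i ltac:(lia)); lia.
Qed.

Lemma metric_triangle_swap u v w :
  metric_triangle V adj u v w -> metric_triangle V adj v u w.
Proof. intros [A [B C]]; repeat split; auto. Qed.

Lemma metric_triangle_equilateral u v w : metric_triangle V adj u v w ->
  d u v = d u w /\ d v w = d u v.
Proof.
  intro M.
  destruct (metric_triangle_equidistant u v w M) as [p [Hp Hc]].
  destruct (metric_triangle_equidistant v u w (metric_triangle_swap _ _ _ M)) as [q [Hq Hc']].
  specialize (Hc _ (le_n _)); specialize (Hc' _ (le_n _)).
  rewrite (proj1 (proj2 Hp)) in Hc; rewrite (proj1 (proj2 Hq)), (gdist_sym v u) in Hc'; auto.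
Qed.

(** * Consequences of the four-point condition *)

(** Integer form with [N] in the role of 2 delta; bounding one sum suffices, as the vertices can be
    permuted. *)
Definition four_point (N : nat) : Prop := forall u v x y,
  d u v + d x y <= Nat.max (d u x + d v y) (d u y + d v x) + N.

(** With side [s] and [p i] a midpoint of [v w], the condition reads [2s <= s + ceil(s/2) + N], so
    [floor(s/2) <= N]. *)
Lemma metric_triangle_bound N u v w : four_point N ->
  metric_triangle V adj u v w -> d u v <= 2 * N + 1.
Proof.
  intros H4 M.
  destruct (metric_triangle_equilateral u v w M) as [E1 E2].
  destruct (metric_triangle_equidistant u v w M) as [p [Hp Hc]].
  pose proof (Nat.div_mod_eq (d v w) 2) as Hdm.
  pose proof (Nat.mod_upper_bound (d v w) 2 ltac:(lia)).
  set (i := d v w / 2) in *.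
  destruct (geodesic_interval v w p i Hp ltac:(lia)) as [A B].
  specialize (Hc i ltac:(lia)); specialize (H4 u (p i) v w).
  rewrite (gdist_sym (p i) v) in H4; lia.
Qed.

Lemma four_point_no_grid N : four_point N ->
  ~ exists f, isometric_grid V adj (S N) f.
Proof.
  intros H4 [f [_ [_ [_ Hf]]]].
  (* The diagonals sum to [4(N+1)], opposite sides only to [2(N+1)]. *)
  specialize (H4 (f 0 0) (f (S N) (S N)) (f 0 (S N)) (f (S N) 0)).
  rewrite !Hf in H4 by lia; unfold absdiff in H4; lia.
Qed.

(** * Completing two geodesics to an isometric grid *)

Section Grid.
Context (y : V) (p q : nat -> V).

Definition lower_neighbor (a b : V) : V :=
  epsilon (inhabits a) (fun x => a ~~ x /\ b ~~ x /\ d y x + 1 = d y a).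

(** Borders are [q] (row 0) and [p] (column 0). The nested [fix] is needed because an entry depends
    on the current and the previous row. *)
Fixpoint grid (i : nat) : nat -> V :=
  match i with
  | 0 => q
  | S i' => fix row j :=
      match j with
      | 0 => p i
      | S j' => lower_neighbor (row j') (grid i' j)
      end
  end.

End Grid.

(** The invariant is [d u (f i j) = d u x - i + j] and [d y (f i j) = d y x - i - j]. *)
Lemma isometric_grid_exists u x y p q k : p 0 = x -> q 0 = x ->
  is_path p k -> is_path q k ->
  (forall i, i <= k -> d u (p i) + i = d u x /\ d y (p i) + i = d y x) ->
  (forall j, j <= k -> d u (q j) = d u x + j /\ d y (q j) + j = d y x) ->
  exists f, isometric_grid V adj k f.
Proof.
  intros P0 Q0 Pp Qp Hpd Hqd.
  pose (f := grid y p q).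
  assert (f00 : forall j, f 0 j = q j) by reflexivity.
  assert (fS0 : forall i, f (S i) 0 = p (S i)) by reflexivity.
  assert (fSS : forall i j, f (S i) (S j) = lower_neighbor y (f (S i) j) (f i (S j)))
    by reflexivity.
  assert (fi0 : forall i, f i 0 = p i) by (intros [|i]; [rewrite f00; congruence|apply fS0]).
  clearbody f.
  assert (Hf : forall i, i <= k -> forall j, j <= k ->
    d u (f i j) + i = d u x + j /\ d y (f i j) + i + j = d y x /\
    (j < k -> 0 < i -> f i j ~~ f i (S j)) /\ (0 < i -> f (i - 1) j ~~ f i j)).
  { induction i as [|i IHi]; intro Hi.
    - intros j Hj; rewrite f00; specialize (Hqd j Hj); repeat split; lia.
    - specialize (IHi ltac:(lia)).
      assert (Hrow : forall j, j < k -> f i j ~~ f i (S j)).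
      { intros j Hj; destruct i; [rewrite !f00; apply Qp; exact Hj|].
        apply IHi; lia. }
      simpl (S i - 1); rewrite Nat.sub_0_r.
      (* The two neighbors [f (S i) j], [f i (S j)] of [f i j] are at distance 2 because
         their distances to [u] differ by 2. *)
      assert (Hcorner : forall j, j < k ->
        d u (f (S i) j) + S i = d u x + j -> d y (f (S i) j) + S i + j = d y x ->
        f i j ~~ f (S i) j ->
        f (S i) j ~~ f (S i) (S j) /\ f i (S j) ~~ f (S i) (S j) /\
        d y (f (S i) (S j)) + 1 = d y (f (S i) j)).
      { intros j Hj Au Ay Aadj.
        destruct (IHi j ltac:(lia)) as [Bu [By _]].
        destruct (IHi (S j) ltac:(lia)) as [Cu [Cy _]].
        specialize (Hrow j Hj).
        rewrite fSS; unfold lower_neighbor; apply epsilon_spec.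
        apply quadrangle_common_neighbor with (f i j); auto using adj_sym; try lia.
        pose proof (gdist_triangle (f (S i) j) (f i j) (f i (S j))).
        pose proof (gdist_triangle u (f (S i) j) (f i (S j))).
        pose proof (gdist_adj _ _ Hrow); pose proof (gdist_adj _ _ Aadj).
        rewrite (gdist_sym (f (S i) j) (f i j)) in *; lia. }
      assert (Hcol : forall j, j <= k -> d u (f (S i) j) + S i = d u x + j /\
        d y (f (S i) j) + S i + j = d y x /\ f i j ~~ f (S i) j).
      { induction j as [|j IHj]; intro Hj.
        - rewrite !fi0; specialize (Hpd (S i) Hi); repeat split; try lia.
          apply Pp; lia.
        - destruct (IHj ltac:(lia)) as [Au [Ay Aadj]].
          destruct (Hcorner j Hj Au Ay Aadj) as [B1 [B2 B3]].
          destruct (IHi (S j) Hj) as [Cu [Cy _]].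
          repeat split; [|lia|exact B2].
          (* (QC) controls only the distance to [y]; that to [u] is squeezed between two neighbors
             whose levels differ by 2. *)
          pose proof (gdist_triangle u (f (S i) j) (f (S i) (S j))).
          pose proof (gdist_triangle u (f (S i) (S j)) (f i (S j))).
          rewrite (gdist_sym (f (S i) (S j)) (f i (S j))) in *.
          rewrite (gdist_adj _ _ B1), (gdist_adj _ _ B2) in *; lia. }
      intros j Hj; destruct (Hcol j Hj) as [Au [Ay Aadj]]; repeat split; auto.
      intros Hj' _; apply Hcorner; auto. }
  assert (Hright : forall i j, i <= k -> j < k -> f i j ~~ f i (S j)).
  { intros [|i] j Hi Hj; [rewrite !f00; apply Qp, Hj|apply Hf; lia]. }
  assert (Hdown : forall i j, i < k -> j <= k -> f i j ~~ f (S i) j).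
  { intros i j Hi Hj; pose proof (Hf (S i) Hi j Hj) as [_ [_ [_ H]]].
    simpl in H; rewrite Nat.sub_0_r in H; apply H; lia. }
  assert (Hupper : forall i j i' j', i <= k -> j <= k -> i' <= k -> j' <= k ->
    d (f i j) (f i' j') <= absdiff i i' + absdiff j j').
  { intros i j i' j' Hi Hj Hi' Hj'.
    pose proof (gdist_triangle (f i j) (f i j') (f i' j')).
    assert (d (f i j) (f i j') <= absdiff j j').
    { assert (is_path (f i) k) as Hp by (intros m Hm; apply Hright; auto).
      unfold absdiff; destruct (le_lt_dec j j').
      - pose proof (path_gdist (f i) k j j' Hp ltac:(lia) ltac:(lia)); lia.
      - rewrite gdist_sym.
        pose proof (path_gdist (f i) k j' j Hp ltac:(lia) ltac:(lia)); lia. }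
    assert (d (f i j') (f i' j') <= absdiff i i').
    { assert (is_path (fun m => f m j') k) as Hp by (intros m Hm; apply Hdown; auto).
      unfold absdiff; destruct (le_lt_dec i i').
      - pose proof (path_gdist _ k i i' Hp ltac:(lia) ltac:(lia)); simpl in *; lia.
      - rewrite gdist_sym.
        pose proof (path_gdist _ k i' i Hp ltac:(lia) ltac:(lia)); simpl in *; lia. }
    lia. }
  assert (Hdist : forall i j i' j', i <= k -> j <= k -> i' <= k -> j' <= k ->
    d (f i j) (f i' j') = absdiff i i' + absdiff j j').
  { intros i j i' j' Hi Hj Hi' Hj'.
    apply Nat.le_antisymm; [apply Hupper; assumption|].
    (* With [a = i - i'] and [b = j - j'], the distances to [u] and [y] differ by [|a - b|] and
       [|a + b|], whose maximum is [|a| + |b|]. *)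
    destruct (Hf i Hi j Hj) as [A1 [A2 _]].
    destruct (Hf i' Hi' j' Hj') as [B1 [B2 _]].
    pose proof (gdist_triangle u (f i j) (f i' j')).
    pose proof (gdist_triangle u (f i' j') (f i j)).
    pose proof (gdist_triangle y (f i j) (f i' j')).
    pose proof (gdist_triangle y (f i' j') (f i j)).
    unfold absdiff; dist_lia. }
  exists f; repeat split; auto.
  all: pose proof (Hdist i j i' j') as E; rewrite H3, gdist_refl in E; unfold absdiff in E; lia.
Qed.

(** * Thin intervals and the converse direction *)

Lemma interval_thin mu kappa u v x y : metric_triangles_le mu ->
  ~ (exists f, isometric_grid V adj kappa f) ->
  in_interval V adj u v x -> in_interval V adj u v y -> d u x = d u y ->
  d x y <= 2 * mu + 2 * kappa.
Proof.
  intros Hmu Hng Ix Iy E.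
  apply Nat.nlt_ge; intro L; apply Hng.
  (* As [x] and [y] are equidistant from [u], and hence from [v], both prefixes have length at least
     [(d x y)/2 - mu > kappa]. *)
  destruct (common_prefix mu x u y Hmu) as [a [Au [Ay Al]]].
  destruct (common_prefix mu x v y Hmu) as [b [Bv [By Bl]]].
  unfold in_interval in *.
  destruct (geodesic_exists x a) as [p Hp].
  destruct (geodesic_exists x b) as [q Hq].
  apply (isometric_grid_exists u x y p q kappa).
  - apply Hp.
  - apply Hq.
  - intros i Hi; apply Hp; dist_lia.
  - intros i Hi; apply Hq; dist_lia.
  - intros i Hi.
    destruct (geodesic_interval x a p i Hp ltac:(dist_lia)) as [C1 C2].
    pose proof (gdist_triangle u (p i) x); pose proof (gdist_triangle u a (p i)).
    pose proof (gdist_triangle y (p i) x); pose proof (gdist_triangle y a (p i)).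
    dist_lia.
  - intros i Hi.
    destruct (geodesic_interval x b q i Hq ltac:(dist_lia)) as [C1 C2].
    pose proof (gdist_triangle u x (q i)); pose proof (gdist_triangle u (q i) v).
    pose proof (gdist_triangle (q i) b v).
    pose proof (gdist_triangle y (q i) x); pose proof (gdist_triangle y b (q i)).
    dist_lia.
Qed.

Lemma interval_point u c t : t <= d u c ->
  exists e, d u e = t /\ d e c = d u c - t.
Proof.
  intro Ht; destruct (geodesic_exists u c) as [p Hp].
  exists (p t); exact (geodesic_interval u c p t Hp Ht).
Qed.

(* [four_point] is the inequality [(x|z)_u >= min ((x|y)_u, (y|z)_u) - N/2]: the prefixes
   shared by [I(u,x)], [I(u,y)] and by [I(u,y)], [I(u,z)] are compared inside [I(u,y)]. *)
Lemma four_point_of_bounds mu kappa : metric_triangles_le mu ->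
  ~ (exists f, isometric_grid V adj kappa f) -> four_point (4 * mu + 2 * kappa).
Proof.
  intros Hmu Hng u y x z.
  destruct (common_prefix mu u x y Hmu) as [a [Ax [Ay Al]]].
  destruct (common_prefix mu u y z Hmu) as [b [By [Bz Bl]]].
  unfold in_interval in *.
  (* Cutting both prefixes at the same length makes [e] and [e'] equidistant from [u], as thinness
     requires. *)
  pose (t := Nat.min (d u a) (d u b)).
  destruct (interval_point u a t ltac:(lia)) as [e [E1 E2]].
  destruct (interval_point u b t ltac:(lia)) as [e' [E1' E2']].
  assert (d e e' <= 2 * mu + 2 * kappa).
  { apply (interval_thin mu kappa u y); unfold in_interval; auto; [| |lia].
    - pose proof (gdist_triangle u e y); pose proof (gdist_triangle e a y); lia.
    - pose proof (gdist_triangle u e' y); pose proof (gdist_triangle e' b y); lia. }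
  (* The route [x], [e], [e'], [z] bounds [d x z]; the error is [2 * mu] from the shorter prefix
     plus the thinness constant. *)
  pose proof (gdist_triangle e a x); pose proof (gdist_triangle e' b z).
  pose proof (gdist_triangle x e z); pose proof (gdist_triangle e e' z).
  dist_lia.
Qed.

(** * Passing between real delta and integer [N] *)

Lemma hyperbolic_four_point delta : hyperbolic V adj delta -> exists N, four_point N.
Proof.
  intro H.
  destruct (INR_unbounded (2 * delta)) as [N HN].
  exists N; intros u v x y.
  destruct (H u v x y) as [Ha _].
  (* Only when the first sum is the largest is there something to prove. *)
  destruct (le_lt_dec (d u v + d x y) (Nat.max (d u x + d v y) (d u y + d v x))); [lia|].
  specialize (Ha ltac:(lia) ltac:(lia)).
  apply INR_le; rewrite (plus_INR (Nat.max _ _)); lra.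
Qed.

Lemma four_point_hyperbolic N : four_point N -> hyperbolic V adj (INR N / 2).
Proof.
  intros H u v x y; cbv zeta.
  assert (Hle : forall a b, a <= b + N -> (INR a - INR b <= 2 * (INR N / 2))%R).
  { intros a b Hab; apply le_INR in Hab; rewrite plus_INR in Hab; lra. }
  pose proof (H u v x y); pose proof (H u x v y); pose proof (H u y v x).
  repeat split; intros _ _; apply Hle; dist_lia.
Qed.

End Modularity.
End WeaklyModular.

Theorem theorem9p6 (V : Type) (adj : V -> V -> Prop)
  (Hsimple : simple_graph V adj) (Hconn : connected V adj)
  (Hwm : weakly_modular V adj) :
  (exists delta : R, hyperbolic V adj delta) <->
  (exists mu kappa : nat,
     (forall v1 v2 v3 : V, metric_triangle V adj v1 v2 v3 ->
        gdist V adj v1 v2 <= mu /\ gdist V adj v2 v3 <= mu /\ gdist V adj v1 v3 <= mu) /\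
     ~ (exists f : nat -> nat -> V, isometric_grid V adj kappa f)).
Proof.
  split.
  - intros [delta H].
    destruct (hyperbolic_four_point V adj delta H) as [N HN].
    exists (2 * N + 1), (S N); split.
    + intros u v w M.
      destruct (metric_triangle_equilateral V adj Hsimple Hconn Hwm u v w M) as [E1 E2].
      pose proof (metric_triangle_bound V adj Hsimple Hconn Hwm N u v w HN M); lia.
    + apply four_point_no_grid; assumption.
  - intros [mu [kappa [Hmu Hng]]].
    exists (INR (4 * mu + 2 * kappa) / 2)%R.
    apply four_point_hyperbolic; auto.
    apply four_point_of_bounds; auto.
Qed.
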